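(* Let $(X,d)$ be a metric space, let $\phi:X\to(-\infty,+\infty]$ be a proper functional, and let $x\in X$, $\tau>0$, $\eta\ge 0$. Then every $x_{\tau,\eta}\in \mathrm J_{\tau,\eta}[x]$ belongs to $\mathrm{Dom}(|\partial\phi|)$ and satisfies the bound $$|\partial\phi|(x_{\tau,\eta})\le \mathfrak L_{-1/\tau}[\phi](x_{\tau,\eta})\le \Big(1+\tfrac12\eta\tau\Big)\frac{d(x,x_{\tau,\eta})}{\tau}.$$ If moreover $\phi$ has complete sublevels (thus in particular it is lower semicontinuous) and is quadratically bounded from below, then for every choice of $x\in\mathrm{Dom}(\phi)$, $\tau\in(0,\tau_o)$ and $\eta>0$ the set $\mathrm J_{\tau,\eta}[x]$ is not empty. In particular, $\mathrm{Dom}(|\partial\phi|)$ is dense in $\mathrm{Dom}(\phi)$.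
   Context: $\mathrm{Dom}(\phi):=\{x\in X:\phi(x)<+\infty\}$; $\phi$ is proper if $\mathrm{Dom}(\phi)\neq\emptyset$. ''Complete sublevels'' means that $\{x\in X:\phi(x)\le c\}$ is complete for every $c\in\mathbb R$. $\phi$ is quadratically bounded from below if there exist $o\in X$, $\phi_o,\kappa_o\in\mathbb R$ with $\phi(x)+\frac{\kappa_o}2 d^2(x,o)\ge\phi_o$ for every $x\in X$. Metric slope: $|\partial\phi|(x):=+\infty$ if $x\notin\mathrm{Dom}(\phi)$; $|\partial\phi|(x):=0$ if $x\in\mathrm{Dom}(\phi)$ is isolated; $|\partial\phi|(x):=\limsup_{y\to x}\frac{(\phi(x)-\phi(y))^+}{d(x,y)}$ otherwise. $\mathrm{Dom}(|\partial\phi|):=\{x\in X:|\partial\phi|(x)<+\infty\}$. Global $\lambda$-slope ($\lambda\in\mathbb R$): $\mathfrak L_\lambda[\phi](x):=\sup_{y\ne x}\frac{(\phi(x)-\phi(y)+\frac\lambda2d^2(x,y))^+}{d(x,y)}$, understood to be $+\infty$ if $x\notin\mathrm{Dom}(\phi)$. Moreau-Yosida regularization: $\phi_\tau(x):=\inf_{y\in X}\big(\phi(y)+\frac1{2\tau}d^2(y,x)\big)$, and $\tau_o:=\sup\{\tau>0:\ \phi_\tau(x)>-\infty\text{ for some }x\in X\}$. Moreau-Yosida-Ekeland resolvent: for $x\in X$, $\tau>0$, $\eta\ge0$, $\mathrm J_{\tau,\eta}[x]$ is the (possibly empty) set of points $x_{\tau,\eta}\in\mathrm{Dom}(\phi)$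 such that both $$\tfrac1{2\tau}d^2(x,x_{\tau,\eta})+\phi(x_{\tau,\eta})\le\tfrac1{2\tau}d^2(x,y)+\phi(y)+\tfrac\eta2\,d(x,x_{\tau,\eta})\,d(y,x_{\tau,\eta})\quad\text{for every }y\in X,$$ $$\tfrac1{2\tau}d^2(x,x_{\tau,\eta})+\phi(x_{\tau,\eta})\le\phi(x).$$ *)

(* Defs.v *)
From mathcomp Require Import all_boot all_order all_algebra.
From mathcomp Require Import all_classical all_reals all_analysis.

Set Implicit Arguments.
Unset Strict Implicit.
Unset Printing Implicit Defensive.

Import Order.TTheory GRing.Theory Num.Theory.

Local Open Scope classical_set_scope.
Local Open Scope ring_scope.
Local Open Scope ereal_scope.

Definition Dom (R : realType) (X : Type) (f : X -> \bar R) : set X :=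
  [set x | f x < +oo].

Definition proper_fun (R : realType) (X : Type) (phi : X -> \bar R) : Prop :=
  Dom phi !=set0.

Definition complete_set (R : realType) (X : metricType R) (A : set X) : Prop :=
  forall u : nat -> X, (forall n, A (u n)) -> cauchy (u @ \oo) ->
    exists2 l, A l & u @ \oo --> l.

Definition complete_sublevels (R : realType) (X : metricType R)
    (phi : X -> \bar R) : Prop :=
  forall c : R, complete_set [set x | phi x <= c%:E].

Definition quadratically_bounded_below (R : realType) (X : metricType R)
    (phi : X -> \bar R) : Prop :=
  exists (o : X) (phio kappao : R),
    forall x, phio%:E <= phi x + (kappao / 2 * mdist x o ^+ 2)%:E.

Definition metric_slope (R : realType) (X : metricType R)
    (phi : X -> \bar R) (x : X) : \bar R :=
  if x \notin Dom phi then +oo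
  else if `[< isolated [set: X] x >] then 0
  else limf_esup
         (fun y => maxe (phi x - phi y) 0 * ((mdist x y)^-1)%:E) (x^').

(* The supremum is taken in [0, +oo], so it is 0 when x is the only point of X;
   [ereal_sup set0] is -oo, hence the added 0. *)
Definition global_slope (R : realType) (X : metricType R) (lambda : R)
    (phi : X -> \bar R) (x : X) : \bar R :=
  if x \notin Dom phi then +oo
  else ereal_sup (0 |`
    [set maxe (phi x - phi y + (lambda / 2 * mdist x y ^+ 2)%:E) 0
         * ((mdist x y)^-1)%:E | y in [set~ x]]).

Definition moreau_yosida (R : realType) (X : metricType R)
    (phi : X -> \bar R) (tau : R) (x : X) : \bar R :=
  ereal_inf [set phi y + ((2 * tau)^-1 * mdist y x ^+ 2)%:E | y in [set: X]].

Definition tau_o (R : realType) (X : metricType R) (phi : X -> \bar R) :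
    \bar R :=
  ereal_sup [set tau%:E | tau in
    [set tau : R | (0 < tau)%R /\ exists x, -oo < moreau_yosida phi tau x]].

Definition resolvent (R : realType) (X : metricType R) (phi : X -> \bar R)
    (tau eta : R) (x : X) : set X :=
  [set z | [/\ Dom phi z,
    forall y, ((2 * tau)^-1 * mdist x z ^+ 2)%:E + phi z
      <= ((2 * tau)^-1 * mdist x y ^+ 2)%:E + phi y
         + (eta / 2 * mdist x z * mdist y z)%:E
    & ((2 * tau)^-1 * mdist x z ^+ 2)%:E + phi z <= phi x]].

Definition dense_in (T : topologicalType) (A B : set T) : Prop :=
  A `<=` B /\ B `<=` closure A.

(* Main.v *)
Require Import Defs.
From mathcomp Require Import all_boot all_order all_algebra.
From mathcomp Require Import all_classical all_reals all_analysis.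
From mathcomp Require Import ring lra.

(* The slope bound at z in J_{tau,eta}[x] comes from expanding
   d(x,y)^2 <= (d(x,z) + d(z,y))^2 in the variational inequality of z; the
   metric slope is below every global slope because the term lambda/2 d^2 is
   o(d).  For existence, tau < tau_o makes F = phi + d(., x)^2 / (2 tau) bounded
   below.  If x does not minimize F, pick y0 with F y0 < phi x: lower
   semicontinuity keeps {F <= F y0} at distance at least r > 0 from x, so the
   Ekeland principle for F, started at y0 with the constant slope eta r / 2,
   gives a point of J_{tau,eta}[x].  Density: as tau tends to 0, the resolvent
   points converge to x by the quadratic lower bound. *)

Import Order.TTheory GRing.Theory Num.Theory.
Import numFieldNormedType.Exports.

Local Open Scope classical_set_scope.
Local Open Scope ring_scope.
Local Open Scope ereal_scope.

(** * Comparison of slopes and the bound at resolvent points *)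

Lemma metric_slope_le_global_slope (R : realType) (X : metricType R)
    (phi : X -> \bar R) (phi_gtNy : forall x, -oo < phi x) (lambda : R) (x : X) :
  metric_slope phi x <= global_slope lambda phi x.
Proof.
rewrite /metric_slope /global_slope; case: ifPn => // /negPn/set_mem/= phix.
set G := ereal_sup _.
have G0 : 0 <= G by apply: ereal_sup_ubound; left.
case: ifPn => // _; apply/lee_addgt0Pr => e e0.
(* On the ball of radius [d] the correction [|lambda| / 2 * d(x,y)] is at most [e]; the [+ 1] keeps
   the denominator positive when [lambda = 0]. *)
pose d : R := (2 * e / (`|lambda| + 1))%R.
have l0 : (0 < `|lambda| + 1)%R by rewrite ltr_wpDl.
have d0 : (0 < d)%R by rewrite divr_gt0// mulr_gt0.
apply: (@le_trans _ _ (ereal_sup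
  ((fun y => maxe (phi x - phi y) 0 * ((mdist x y)^-1)%:E)
   @` (ball x d `&` [set~ x])))).
  apply: ereal_inf_lbound; exists (ball x d `&` [set~ x]) => //.
  apply: (@filterS _ (nbhs x) _ (ball x d)); last exact: nbhsx_ballx.
  by move=> y xy /eqP yx; split.
apply: ge_ereal_sup => _ [y [+ yx]] <-; rewrite ballEmdist/= => xyd.
have xy0 : (0 < mdist x y)%R by rewrite mdist_gt0; apply/eqP => /esym.
have ler : (`|lambda| / 2 * mdist x y <= e)%R.
  move: xyd; rewrite /d ltr_pdivlMr// => xyd.
  have : (0 <= mdist x y)%R := ltW xy0.
  by nra.
have : maxe (phi x - phi y + (lambda / 2 * mdist x y ^+ 2)%:E) 0
    * ((mdist x y)^-1)%:E <= G.
  by apply: ereal_sup_ubound; right; exists y.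
move=> /(leeD2r e%:E); apply: le_trans.
move: phix (phi_gtNy x) (phi_gtNy y); rewrite /Dom/=.
case: (phi x) => [a||]// _ _; case: (phi y) => [b||]// _; last first.
  by rewrite max_r ?leNye// mul0e add0e lee_fin ltW.
rewrite -!EFinB -!EFinD -!EFin_max -!EFinM -EFinD lee_fin.
rewrite ler_pdivrMr// mulrDl divfK ?gt_eqF//.
have : (- (lambda / 2 * mdist x y ^+ 2) <= e * mdist x y)%R.
  apply: (@le_trans _ _ (`|lambda| / 2 * mdist x y * mdist x y)%R).
    have := ler_norm (- lambda)%R; rewrite normrN.
    have : (0 <= mdist x y * mdist x y)%R by rewrite mulr_ge0// ltW.
    by nra.
  by rewrite ler_pM2r.
have e1 : (0 <= e * mdist x y)%R by rewrite mulr_ge0// ltW.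
set q := (lambda / 2 * _)%R; set r := (e * _)%R in e1 *; move=> h.
rewrite ge_max; apply/andP; split.
  have : (a - b + q <= Num.max (a - b + q) 0)%R by rewrite le_max lexx.
  by lra.
by rewrite addr_ge0// le_max lexx orbT.
Qed.

Lemma global_slope_resolvent_le (R : realType) (X : metricType R)
    (phi : X -> \bar R) (phi_gtNy : forall x, -oo < phi x)
    (x z : X) (tau eta : R) :
  (0 < tau)%R -> (0 <= eta)%R -> resolvent phi tau eta x z ->
  global_slope (- tau^-1)%R phi z
    <= ((1 + 2^-1 * eta * tau) * (mdist x z / tau))%:E.
Proof.
move=> tau0 eta0 [phiz zmin _].
have K0 : (0 <= (1 + 2^-1 * eta * tau) * (mdist x z / tau))%R.
  rewrite mulr_ge0 ?divr_ge0 ?mdist_ge0 ?(ltW tau0)// addr_ge0//.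
  by rewrite !mulr_ge0// ltW.
rewrite /global_slope (_ : z \notin _ = false); last first.
  by apply/negbTE; rewrite negbK inE.
apply: ge_ereal_sup => _ [->|[y /= yz <-]]; first by rewrite lee_fin.
have := zmin y; move: phiz (phi_gtNy z) (phi_gtNy y); rewrite /Dom/=.
have zy0 : (0 < mdist z y)%R by rewrite mdist_gt0; apply/eqP => /esym.
case: (phi z) => [a||]// _ _; case: (phi y) => [b||]// _; last first.
  by move=> _ /=; rewrite max_r ?leNye// mul0e lee_fin.
rewrite -!EFinB -!EFinD !lee_fin -EFin_max -EFinM lee_fin => h.
rewrite ler_pdivrMr// ge_max; apply/andP; split; last by rewrite mulr_ge0// ltW.
have := metric_triangle x z y; have := mdist_ge0 x y; have := mdist_ge0 x z.
move: h; rewrite (metric_sym y z); move: zy0.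
(* The first summand is the cross term of [(d(x,z) + d(z,y))^2 / (2 tau)], the second the error term
   of the resolvent; the remaining [d(z,y)^2 / (2 tau)] is cancelled by [lambda = - 1 / tau]. *)
have -> : ((1 + 2^-1 * eta * tau) * (mdist x z / tau) * mdist z y =
  tau^-1 * (mdist x z * mdist z y) + eta / 2 * mdist x z * mdist z y)%R.
  by field; rewrite gt_eqF.
rewrite invfM; have : (0 < tau^-1)%R by rewrite invr_gt0.
move: (mdist x z) (mdist x y) (mdist z y) tau^-1%R => p q r t t0 r0 h p0 q0 qpr.
have : (t * q ^+ 2 <= t * (p + r) ^+ 2)%R.
  by rewrite ler_pM2l// ler_sqr ?nnegrE// addr_ge0// ltW.
by move: h; nra.
Qed.

(** * Completeness of sublevels and lower semicontinuity *)

Lemma cvg_seq_cauchy (R : realType) (X : metricType R) (u : nat -> X) (l : X) :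
  u @ \oo --> l -> cauchy (u @ \oo).
Proof.
move=> ul; apply: cauchy_exP => e e0; exists l.
by move/cvg_ballP : ul => /(_ _ e0).
Qed.

(** Complete sublevels are closed: a failure at [x] yields points of one sublevel converging to [x],
    whose limit inside the sublevel must be [x] because limits are unique. *)
Lemma complete_sublevels_lsc (R : realType) (X : metricType R)
    (phi : X -> \bar R) :
  complete_sublevels phi -> lower_semicontinuous phi.
Proof.
move=> cphi x a aphi; apply: contrapT => nV.
have [u /all_and2[xu ua]] : {u : nat -> X &
    forall n, ball x n.+1%:R^-1 (u n) /\ phi (u n) <= a%:E}.
  apply: (@choice _ _ (fun n y => ball x n.+1%:R^-1 y /\ phi y <= a%:E)) => n.
  apply: contrapT => ny; apply: nV; exists (ball x n.+1%:R^-1).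
    by apply: nbhsx_ballx; rewrite invr_gt0.
  by move=> y xy; rewrite ltNge; apply/negP => ya; apply: ny; exists y.
have ux : u @ \oo --> x.
  apply/cvg_ballP => e e0; near=> n.
  apply: (@le_ball _ _ _ n.+1%:R^-1); last exact: xu.
  by apply/ltW; near: n; exact: near_infty_natSinv_lt (PosNum e0).
have [l la ul] := cphi a u ua (cvg_seq_cauchy _ _ _ _ ux).
have xl : x = l by apply: cvg_unique ux ul; exact: metric_hausdorff.
by move: aphi; rewrite xl ltNge => /negP; apply.
Unshelve. all: by end_near. Qed.

Lemma lower_semicontinuous_addr (R : realType) (T : topologicalType)
    (f : T -> \bar R) (h : T -> R) (f_gtNy : forall x, -oo < f x) :
  lower_semicontinuous f -> continuous h ->
  lower_semicontinuous (fun x => f x + (h x)%:E).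
Proof.
move=> lf ch x a afh.
(* The level [a] is split as [b + (a - b)], each summand strictly below its function at [x]; if
   [f x] is infinite, only the bound on [h x] restricts [b]. *)
have [b bf bh] : exists2 b : R, b%:E < f x & (a - b < h x)%R.
  move: afh (f_gtNy x); case: (f x) => [r||]//.
    rewrite -EFinD lte_fin => ar _; exists ((r + (a - h x)) / 2)%R.
      by rewrite lte_fin; lra.
    by lra.
  by move=> _ _; exists (a - h x + 1)%R; [rewrite ltry|lra].
have [V Vx Vf] := lf x b bf.
exists (V `&` [set y | (a - b < h y)%R]).
  by apply: filterI => //; exact: cvgr_gt (ch x) _ bh.
move=> y [/Vf + /=]; case: (f y) => [r||]//.
  by rewrite -EFinD !lte_fin; lra.
by move=> _ _; rewrite addye// ltry.
Qed.

Lemma lower_semicontinuous_cvg_le (R : realType) (T : topologicalType)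
    (f : T -> \bar R) (u : nat -> T) (l : T) (c : R) :
  lower_semicontinuous f -> u @ \oo --> l ->
  (\forall n \near \oo, f (u n) <= c%:E) -> f l <= c%:E.
Proof.
move=> lf ul fu; rewrite leNgt; apply/negP => /lf[V Vl Vf].
have [n [/= fn /Vf]] := filter_ex (filterI fu (ul _ Vl)).
by rewrite ltNge fn.
Qed.

(** Each sublevel of [psi] is a closed subset of the complete sublevel of [phi] at the same height.
    This carries completeness over to [phi] plus a quadratic penalty. *)
Lemma complete_sublevels_ge (R : realType) (X : metricType R)
    (phi psi : X -> \bar R) :
  complete_sublevels phi -> lower_semicontinuous psi ->
  (forall x, phi x <= psi x) -> complete_sublevels psi.
Proof.
move=> cphi lpsi phipsi c u uc uC.
have [l _ ul] := cphi c u (fun n => le_trans (phipsi _) (uc n)) uC.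
by exists l => //; apply: lower_semicontinuous_cvg_le ul _ => //; exact: nearW.
Qed.

Lemma mdist_continuous (R : realType) (X : metricType R) (x : X) :
  continuous (fun y => mdist y x).
Proof.
move=> y; apply/cvgrPdist_le => e e0; near=> z.
have : (mdist y z < e)%R.
  by near: z; have := nbhsx_ballx y _ e0; rewrite ballEmdist.
have := metric_triangle y z x; have := metric_triangle z y x.
by rewrite (metric_sym z y) ler_norml; lra.
Unshelve. all: by end_near. Qed.

(** * Ekeland's variational principle *)

Lemma ekeland (R : realType) (X : metricType R) (phi : X -> \bar R)
    (m eps : R) (x0 : X) :
  complete_sublevels phi -> (forall x, m%:E <= phi x) -> (0 < eps)%R ->
  Dom phi x0 ->
  exists2 z, phi z + (eps * mdist z x0)%:E <= phi x0 &
    forall y, phi z <= phi y + (eps * mdist y z)%:E.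
Proof.
move=> cphi mphi eps0 phix0.
have phi_gtNy x : -oo < phi x by exact: lt_le_trans (ltNyr m) (mphi x).
pose S z := [set y | phi y + (eps * mdist y z)%:E <= phi z].
have Sxx z : S z z by rewrite /S/= mdistxx mulr0 adde0.
(* [T z] lies at most half way between [phi z] and [inf phi] over [S z], so a
   point that belongs to every [S] along the orbit of [T] minimizes [phi]. *)
have [T TP] : {T : X -> X & forall z, Dom phi z ->
    S z (T z) /\ forall y, S z y -> phi (T z) + phi (T z) <= phi y + phi z}.
  apply: (@choice _ _ (fun z w => Dom phi z ->
    S z w /\ forall y, S z y -> phi w + phi w <= phi y + phi z)) => z.
  have [phiz|] := pselect (Dom phi z); last by exists z.
  pose I := ereal_inf (phi @` S z).
  have Iphi y : S z y -> I <= phi y by move=> Szy; apply: ereal_inf_lbound; exists y.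
  have mI : m%:E <= I by apply: le_ereal_inf_tmp => _ [y _ <-].
  have [zI|Iz] := leP (phi z) I.
    by exists z => _; split=> // y /Iphi/(le_trans zI)/leeD2r; apply.
  have Ifin : I \is a fin_num.
    rewrite fin_numE -ltNye (lt_le_trans (ltNyr m) mI)/= -ltey.
    exact: lt_trans Iz phiz.
  have zfin : phi z \is a fin_num by rewrite fin_numE -ltNye phi_gtNy -ltey.
  have e0 : (0 < (fine (phi z) - fine I) / 2)%R.
    by rewrite divr_gt0// subr_gt0 fine_lt.
  have [_ [w Szw <-] wI] := lb_ereal_inf_adherent e0 Ifin.
  exists w => _; split=> // y /Iphi Iy.
  apply: (@le_trans _ _ (I + phi z)); last exact: leeD2r.
  move: wI (phi_gtNy w); rewrite -/I -(fineK Ifin) -(fineK zfin).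
  by case: (phi w) => [r||]//; rewrite -!EFinD lte_fin lee_fin; lra.
pose u n := iter n T x0.
have phiu n : Dom phi (u n).
  elim: n => [//|n un]; have [+ _] := TP _ un; rewrite /S/=.
  move=> /le_lt_trans-/(_ _ un); apply: le_lt_trans.
  by rewrite leeDl// lee_fin mulr_ge0 ?mdist_ge0// ltW.
pose a n := fine (phi (u n)).
have phiuE n : phi (u n) = (a n)%:E.
  by rewrite fineK// fin_numE -ltNye phi_gtNy -ltey phiu.
(* The one-step descents telescope by the triangle inequality, so every later orbit point lies in
   [S (u n)]. *)
have au n k : (a (k + n)%N + eps * mdist (u (k + n)%N) (u n) <= a n)%R.
  elim: k => [|k ih]; first by rewrite add0n mdistxx mulr0 addr0.
  have [+ _] := TP _ (phiu (k + n)%N).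
  rewrite /S/= -[T _]/(u (k + n).+1) !phiuE -EFinD lee_fin -addSn => h.
  have := metric_triangle (u (k.+1 + n)%N) (u (k + n)%N) (u n).
  by rewrite -(ler_pM2l eps0); lra.
have a_inf : has_inf (range a).
  split; first by exists (a 0%N), 0%N.
  by exists m => _ [n _ <-]; rewrite -lee_fin -phiuE.
pose I := inf (range a).
have Ia n : (I <= a n)%R by apply: inf_lbound; [case: a_inf|exists n].
(* Once [a N] is within [eps * e] of its infimum, the descent left bounds all later distances to
   [u N] by [e]. *)
have u_cauchy : cauchy (u @ \oo).
  apply: cauchy_exP => e e0.
  have [_ [N _ <-] aN] := inf_adherent (mulr_gt0 eps0 e0) a_inf.
  exists (u N); exists N => // n /= /subnK <-.
  rewrite ballEmdist/= metric_sym -(ltr_pM2l eps0).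
  by have := au N (n - N)%N; have := Ia (n - N + N)%N; rewrite -/I in aN; lra.
have [l _ ul] : exists2 l, [set x | phi x <= (a 0%N)%:E] l & u @ \oo --> l.
  apply: cphi => // n /=; rewrite phiuE lee_fin.
  have := au 0%N n; rewrite addn0; apply: le_trans.
  by rewrite lerDl mulr_ge0 ?mdist_ge0// ltW.
have Sl n : phi l + (eps * mdist l (u n))%:E <= (a n)%:E.
  apply: (lower_semicontinuous_cvg_le _ _
    (fun y => phi y + (eps * mdist y (u n))%:E) _ _ _ _ ul).
    apply: (lower_semicontinuous_addr _ _ _ (fun y => (eps * mdist y (u n))%R)).
    - exact: phi_gtNy.
    - exact: complete_sublevels_lsc.
    - by move=> y; apply: cvgMr; exact: mdist_continuous.
  exists n => // k /= /subnK <-.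
  by rewrite phiuE -EFinD lee_fin au.
exists l; first by have := Sl 0%N; rewrite -phiuE.
move=> y; rewrite leNgt; apply/negP => yl.
(* A [y] violating minimality lies in [S l], and the relation defining [S] is transitive. *)
have Sy n : phi y + (eps * mdist y (u n))%:E <= (a n)%:E.
  apply: le_trans (Sl n).
  apply: (@le_trans _ _
    (phi y + (eps * mdist y l)%:E + (eps * mdist l (u n))%:E)).
    rewrite -addeA leeD2l// -EFinD lee_fin -mulrDr ler_pM2l//.
    exact: metric_triangle.
  by apply: leeD2r; exact: ltW.
move: yl (phi_gtNy y) (phi_gtNy l) (Sl 0%N).
case phiy : (phi y) => [b||]//; case phil : (phi l) => [c||]//.
rewrite -!EFinD lte_fin => yl _ _ _.
have bc : (0 < c - b)%R.
  have : (0 <= eps * mdist y l)%R by rewrite mulr_ge0 ?mdist_ge0// ltW.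
  by lra.
have cI : (c <= I)%R.
  apply: lb_le_inf; first by case: a_inf.
  move=> _ [n _ <-]; have := Sl n; rewrite phil -EFinD lee_fin.
  apply: le_trans; rewrite lerDl mulr_ge0 ?mdist_ge0//; exact: ltW.
(* For [a N < I + (c - b)], the choice of [T] gives [2 a (N+1) <= b + a N < I + c <= 2 I], against
   [I <= a (N+1)]. *)
have [_ [N _ <-] aN] := inf_adherent bc a_inf.
have [_ /(_ y)] := TP _ (phiu N).
rewrite /S/= -[T _]/(u N.+1) !phiuE => /(_ (Sy N)).
rewrite phiy -!EFinD lee_fin; have := Ia N.+1; rewrite -/I in aN; lra.
Qed.

(** * Finite slope at resolvent points and their existence *)

Lemma resolvent_Dom_metric_slope (R : realType) (X : metricType R)
    (phi : X -> \bar R) (phi_gtNy : forall x, -oo < phi x)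
    (x z : X) (tau eta : R) :
  (0 < tau)%R -> (0 <= eta)%R -> resolvent phi tau eta x z ->
  Dom (metric_slope phi) z.
Proof.
move=> tau0 eta0 Jz; apply: le_lt_trans (metric_slope_le_global_slope _ _ _
  phi_gtNy (- tau^-1)%R z) _.
apply: le_lt_trans (ltry _).
exact: (global_slope_resolvent_le _ _ _ phi_gtNy _ _ _ _ tau0 eta0 Jz).
Qed.

Lemma moreau_yosida_lower_bound (R : realType) (X : metricType R)
    (phi : X -> \bar R) (tau : R) (x : X) :
  -oo < moreau_yosida phi tau x ->
  exists m : R, forall y, m%:E <= phi y + ((2 * tau)^-1 * mdist y x ^+ 2)%:E.
Proof.
move=> phix; have [m mphi] : exists m : R, m%:E <= moreau_yosida phi tau x.
  move: phix; case: moreau_yosida => [r||]// _; first by exists r.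
  by exists 0%R; rewrite leey.
exists m => y; apply: le_trans mphi _.
by apply: ereal_inf_lbound; exists y.
Qed.

Lemma resolvent_nonempty (R : realType) (X : metricType R)
    (phi : X -> \bar R) (phi_gtNy : forall x, -oo < phi x)
    (x : X) (tau eta : R) :
  complete_sublevels phi -> Dom phi x -> (0 < tau)%R ->
  tau%:E < tau_o phi -> (0 < eta)%R -> resolvent phi tau eta x !=set0.
Proof.
move=> cphi phix tau0 /ereal_sup_gt[t [tau' [tau'0 [p]]]].
move=> /moreau_yosida_lower_bound[m phim] <-; rewrite lte_fin => tautau' eta0.
have kk' : ((2 * tau')^-1 < (2 * tau)^-1)%R.
  by rewrite ltf_pV2 ?posrE ?mulr_gt0// ltr_pM2l.
have k'0 : (0 < (2 * tau')^-1)%R by rewrite invr_gt0 mulr_gt0.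
rewrite /resolvent; move: kk' k'0 phim => {tau0 tau'0 tautau'}.
move: (2 * tau)^-1%R (2 * tau')^-1%R => k k' k'k k'0 phim.
have k0 : (0 < k)%R by exact: lt_trans k'k.
pose F y := phi y + (k * mdist y x ^+ 2)%:E.
have Fphi y : phi y <= F y.
  by rewrite leeDl// lee_fin mulr_ge0 ?sqr_ge0// ltW.
have FE y : (k * mdist x y ^+ 2)%:E + phi y = F y by rewrite addeC metric_sym.
have cF : complete_sublevels F.
  apply: (complete_sublevels_ge _ _ _ _ cphi _ Fphi).
  apply: (lower_semicontinuous_addr _ _ _ (fun y => (k * mdist y x ^+ 2)%R)).
  - exact: phi_gtNy.
  - exact: complete_sublevels_lsc.
  - move=> y; apply: cvgMr.
    exact: cvgM (mdist_continuous _ _ x y) (mdist_continuous _ _ x y).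
(* The lower bound centred at [p] is moved to [x], using the gap [k' < k]; the constant is the
   maximum over [t] of [k' (t + s)^2 - k t^2] with [s = d(x,p)]. *)
have Fm y : (m - k * k' / (k - k') * mdist x p ^+ 2)%:E <= F y.
  have := phim y; rewrite /F; move: (phi_gtNy y).
  case: (phi y) => [r||]// _; last by move=> _; rewrite addye// leey.
  rewrite -!EFinD !lee_fin.
  have : (k' * mdist y p ^+ 2 <= k' * (mdist y x + mdist x p) ^+ 2)%R.
    rewrite ler_pM2l// ler_sqr ?nnegrE ?addr_ge0 ?mdist_ge0//.
    exact: metric_triangle.
  (* Young's inequality, with the weights that turn [k'] into [k] *)
  have : (0 <= k * mdist y x ^+ 2 + k * k' / (k - k') * mdist x p ^+ 2
      - k' * (mdist y x + mdist x p) ^+ 2)%R.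
    have -> : (k * mdist y x ^+ 2 + k * k' / (k - k') * mdist x p ^+ 2
      - k' * (mdist y x + mdist x p) ^+ 2 =
      ((k - k') * mdist y x - k' * mdist x p) ^+ 2 / (k - k'))%R.
      by field; rewrite subr_eq0 gt_eqF.
    by rewrite divr_ge0 ?sqr_ge0// subr_ge0 ltW.
  lra.
have [xmin|] := pselect (forall y, phi x <= F y).
  have Fx : F x = phi x by rewrite /F mdistxx expr0n/= mulr0 adde0.
  exists x; split => // [y|]; rewrite !FE Fx//.
  by rewrite mdistxx mulr0 mul0r adde0 xmin.
move=> /existsNP[y0 /negP]; rewrite -ltNge => y0x.
have FyE : F y0 = (fine (F y0))%:E.
  rewrite fineK// fin_numE -ltNye (lt_le_trans (ltNyr _) (Fm y0))/= -ltey.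
  exact: lt_trans phix.
rewrite FyE in y0x.
have [V /nbhs_ballP[r /= r0 rV] Vphi] := complete_sublevels_lsc _ _ _ cphi _ _ y0x.
have er0 : (0 < eta / 2 * r)%R by rewrite !mulr_gt0.
have Fy0 : Dom F y0 by rewrite /Dom/= FyE ltry.
have [z zy0 zmin] := ekeland _ _ _ _ _ _ cF Fm er0 Fy0.
have Fz : F z <= F y0.
  apply: le_trans zy0; rewrite leeDl// lee_fin.
  by rewrite mulr_ge0 ?mdist_ge0// ltW.
(* [F z <= F y0 < phi x], so lower semicontinuity keeps [z] away from [x] *)
have rz : (r <= mdist x z)%R.
  rewrite leNgt; apply/negP => xzr.
  have /Vphi : V z by apply: rV; rewrite ballEmdist.
  by rewrite ltNge -FyE (le_trans (Fphi z)).
exists z; split=> [|y|].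
- by apply: le_lt_trans (Fphi z) _; apply: le_lt_trans Fz _.
(* By [r <= d(x,z)], the Ekeland slope [eta r / 2] is at most the coefficient [eta / 2 * d(x,z)]
   allowed in the resolvent. *)
- rewrite !FE; apply: le_trans (zmin y) _; rewrite leeD2l// lee_fin.
  by rewrite ler_wpM2r ?mdist_ge0// ler_pM2l// divr_gt0.
- by rewrite FE (le_trans Fz)// FyE ltW.
Qed.

(** * Density of the domain of the slope *)

(** At [tau = 1 / kappa] the Moreau-Yosida penalty is exactly [kappa / 2 * d^2], so the
    regularization at [o] is at least [c]. Hence small time steps are admissible. *)
Lemma tau_o_ge (R : realType) (X : metricType R) (phi : X -> \bar R)
    (o : X) (c kappa : R) : (0 < kappa)%R ->
  (forall x, c%:E <= phi x + (kappa / 2 * mdist x o ^+ 2)%:E) ->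
  (kappa^-1)%:E <= tau_o phi.
Proof.
move=> k0 phic; apply: ereal_sup_ubound; exists kappa^-1%R => //.
split; first by rewrite invr_gt0.
exists o; apply: (@lt_le_trans _ _ c%:E); first exact: ltNyr.
apply: le_ereal_inf_tmp => _ [y _ <-]; apply: le_trans (phic y) _.
by rewrite invfM invrK (mulrC 2^-1%R).
Qed.

Lemma Dom_metric_slope_dense (R : realType) (X : metricType R)
    (phi : X -> \bar R) (phi_gtNy : forall x, -oo < phi x) :
  complete_sublevels phi -> quadratically_bounded_below phi ->
  dense_in (Dom (metric_slope phi)) (Dom phi).
Proof.
move=> cphi [p [c [kappa phic]]]; split=> [x|x phix B].
  rewrite /Dom/= /metric_slope; case: ifPn => [_|]; first by rewrite ltxx.
  by move=> /negPn/set_mem.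
move=> /nbhs_ballP[r /= r0 rB].
(* The given [kappa] may be nonpositive; a positive constant is needed to invert it. *)
pose K := Num.max kappa 1%R.
have kK : (kappa <= K)%R by rewrite le_max lexx.
have K0 : (0 < K)%R by rewrite lt_max ltr01 orbT.
have phiK y : c%:E <= phi y + (K / 2 * mdist y p ^+ 2)%:E.
  apply: le_trans (phic y) _; rewrite leeD2l// lee_fin.
  by rewrite ler_wpM2r ?sqr_ge0// ler_wpM2r.
(* With [1 / (2 tau) = K + s], the quadratic bound at [z] and [d(z,p)^2 <= 2 d(x,z)^2 + 2 d(x,p)^2]
   use up the [K] share and leave [s d(x,z)^2 <= C]. As [s r^2 = |C| + 1 > C], this forces
   [d(x,z) < r]. *)
pose C := (fine (phi x) - c + K * mdist x p ^+ 2)%R.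
pose s := ((`|C| + 1) / r ^+ 2)%R.
have s0 : (0 < s)%R by rewrite divr_gt0 ?exprn_gt0// ltr_wpDl.
pose tau := ((2 * (K + s))^-1)%R.
have tau0 : (0 < tau)%R by rewrite invr_gt0 mulr_gt0// addr_gt0.
have tauo : tau%:E < tau_o phi.
  apply: lt_le_trans (tau_o_ge _ _ _ _ _ _ K0 phiK); rewrite lte_fin.
  by rewrite ltf_pV2 ?posrE ?mulr_gt0 ?addr_gt0//; lra.
have [z Jz] := resolvent_nonempty _ _ _ phi_gtNy x tau 1 cphi phix tau0 tauo ltr01.
exists z; split; first exact: resolvent_Dom_metric_slope Jz.
apply: rB; rewrite ballEmdist/=.
case: Jz => _ _; have -> : ((2 * tau)^-1 = K + s)%R.
  by rewrite /tau; field; rewrite gt_eqF// addr_gt0.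
move: phix (phi_gtNy x) (phi_gtNy z) (phiK z); rewrite /Dom/=.
case phixE : (phi x) => [a||]// _ _.
case: (phi z) => [b||]// _; rewrite -!EFinD !lee_fin => cb ab.
have h1 : (mdist z p ^+ 2 <= 2 * mdist x z ^+ 2 + 2 * mdist x p ^+ 2)%R.
  have := metric_triangle z x p; rewrite (metric_sym z x) => h.
  apply: (@le_trans _ _ ((mdist x z + mdist x p) ^+ 2)%R).
    by rewrite ler_sqr ?nnegrE ?addr_ge0 ?mdist_ge0.
  by have := sqr_ge0 (mdist x z - mdist x p)%R; lra.
have h2 : (s * mdist x z ^+ 2 <= C)%R.
  by rewrite /C phixE/=; move: h1; rewrite -(ler_pM2l K0); lra.
have : (s * mdist x z ^+ 2 < s * r ^+ 2)%R.
  rewrite divfK ?gt_eqF ?exprn_gt0//.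
  by have := ler_norm C; lra.
by rewrite ltr_pM2l// ltr_sqr// ?nnegrE ?mdist_ge0// ltW.
Qed.

Theorem theorem2p10 (R : realType) (X : metricType R) (phi : X -> \bar R)
    (phi_gtNy : forall x, -oo < phi x) (phi_proper : proper_fun phi) :
  (forall (x : X) (tau eta : R), (0 < tau)%R -> (0 <= eta)%R ->
     forall z, resolvent phi tau eta x z ->
       [/\ Dom (metric_slope phi) z,
           metric_slope phi z <= global_slope (- tau^-1)%R phi z
         & global_slope (- tau^-1)%R phi z
             <= ((1 + 2^-1 * eta * tau) * (mdist x z / tau))%:E])
  /\ (complete_sublevels phi -> lower_semicontinuous phi)
  /\ (complete_sublevels phi -> quadratically_bounded_below phi ->
      (forall (x : X) (tau eta : R),
         Dom phi x -> (0 < tau)%R -> tau%:E < tau_o phi -> (0 < eta)%R ->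
         resolvent phi tau eta x !=set0)
      /\ dense_in (Dom (metric_slope phi)) (Dom phi)).
Proof.
split=> [x tau eta tau0 eta0 z Jz|].
  split; first exact: resolvent_Dom_metric_slope Jz.
    exact: metric_slope_le_global_slope.
  exact: global_slope_resolvent_le Jz.
split; first exact: complete_sublevels_lsc.
move=> cphi qphi; split=> [x tau eta phix tau0 tauo eta0|].
  exact: resolvent_nonempty.
exact: Dom_metric_slope_dense.
Qed.
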